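(* Let $s\ge 1$ be an integer, let $h>0$, and let $\sigma$ be a polynomial of degree at most $s$ with values in $\mathbb{R}^m$ such that $\sigma(0)=y_0$ and $$\dot\sigma(ch)=\sum_{i=0}^{s-1}P_i(c)\,\Gamma_i^s(\sigma),\qquad c\in[0,1],\qquad \Gamma_i^s(\sigma)=\sum_{j=0}^{s-1}\rho_{ij}(\sigma)\gamma_j(\sigma),\quad i=0,\dots,s-1,$$ and set $y_1:=\sigma(h)$. Then $H(y_1)=H(y_0)$, i.e., the method is energy-conserving.
   Context: Consider the problem $\dot y=S(y)\nabla H(y)$, $t\in[0,h]$, $y(0)=y_0\in\mathbb{R}^m$, where $H$ is a real-valued function and $S(y)=-S(y)^\top$ is an $m\times m$ skew-symmetric matrix for every $y$; $S$ and $\nabla H$ are assumed to be smooth. $\{P_i\}_{i\ge0}$ denotes the Legendre polynomial basis orthonormal on $[0,1]$: $P_i$ has degree $i$, $P_0\equiv 1$, and $\int_0^1P_i(x)P_j(x)\,dx=\delta_{ij}$. For a path $\sigma:[0,h]\to\mathbb{R}^m$ define $$\gamma_j(\sigma)=\int_0^1P_j(\tau)\nabla H(\sigma(\tau h))\,d\tau,\qquad \rho_{ij}(\sigma)=\int_0^1P_i(\tau)P_j(\tau)S(\sigma(\tau h))\,d\tau .$$ The dot denotes the derivative with respect to time $t=ch$. Equivalently, $\sigma(ch)=y_0+h\sum_{i=0}^{s-1}\int_0^cP_i(x)\,dx\,\Gamma_i^s(\sigma)$ and $y_1=y_0+h\Gamma_0^s(\sigma)$. *)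

(* Defs.v *)
From HB Require Import structures.
From mathcomp Require Import all_boot all_order all_algebra.
From mathcomp Require Import all_classical all_reals all_analysis.
Set Implicit Arguments.
Unset Strict Implicit.
Unset Printing Implicit Defensive.
Import Order.TTheory GRing.Theory Num.Theory.
Import numFieldNormedType.Exports.
Local Open Scope classical_set_scope.
Local Open Scope ring_scope.

(* f is C^{k+1} iff f is (Frechet) differentiable and all its directional
   derivatives are C^k; the source is R^m, so this is the usual notion. *)
Fixpoint of_class_C (R : realType) (m : nat) (W : normedModType R) (k : nat)
    (f : 'cV[R]_m -> W) : Prop :=
  if k is k'.+1 then
    (forall y : 'cV[R]_m, differentiable f y) /\
    (forall v : 'cV[R]_m, of_class_C k' ('D_v f))
  else continuous f.

Definition smooth (R : realType) (m : nat) (W : normedModType R)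
    (f : 'cV[R]_m -> W) : Prop :=
  forall k : nat, of_class_C k f.

Definition grad (R : realType) (m : nat) (H : 'cV[R]_m -> R)
    (y : 'cV[R]_m) : 'cV[R]_m :=
  \col_(k < m) 'D_(delta_mx k 0) H y.

Definition skew_symmetric (R : realType) (m : nat) (A : 'M[R]_m) : Prop :=
  A = - A^T.

(* These conditions determine each P i with i > 0 up to sign; no sign
   convention is imposed. *)
Definition orthonormal_legendre (R : realType) (P : nat -> {poly R}) : Prop :=
  [/\ forall i, size (P i) = i.+1,
      P 0%N = 1
    & forall i j, \int[lebesgue_measure]_(x in `[0%R, 1%R])
        ((P i).[x] * (P j).[x]) = (i == j)%:R].

Definition polynomial_path (R : realType) (m s : nat) (sigma : R -> 'cV[R]_m)
    : Prop :=
  exists p : 'I_m -> {poly R},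
    (forall k, (size (p k) <= s.+1)%N) /\
    (forall t, sigma t = \col_(k < m) (p k).[t]).

(* Integrals of vector- and matrix-valued functions are entrywise. *)
Definition gamma_coef (R : realType) (m : nat) (P : nat -> {poly R})
    (H : 'cV[R]_m -> R) (h : R) (sigma : R -> 'cV[R]_m) (j : nat) : 'cV[R]_m :=
  \col_(k < m) \int[lebesgue_measure]_(tau in `[0%R, 1%R])
    ((P j).[tau] * grad H (sigma (tau * h)) k 0).

Definition rho_coef (R : realType) (m : nat) (P : nat -> {poly R})
    (S : 'cV[R]_m -> 'M[R]_m) (h : R) (sigma : R -> 'cV[R]_m) (i j : nat)
    : 'M[R]_m :=
  \matrix_(k < m, l < m) \int[lebesgue_measure]_(tau in `[0%R, 1%R])
    ((P i).[tau] * (P j).[tau] * S (sigma (tau * h)) k l).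

Definition Gamma_coef (R : realType) (m : nat) (P : nat -> {poly R})
    (S : 'cV[R]_m -> 'M[R]_m) (H : 'cV[R]_m -> R) (h : R)
    (sigma : R -> 'cV[R]_m) (s i : nat) : 'cV[R]_m :=
  \sum_(j < s) rho_coef P S h sigma i j *m gamma_coef P H h sigma j.

(* Main.v *)
Require Import Defs.
From HB Require Import structures.
From mathcomp Require Import all_boot all_order all_algebra.
From mathcomp Require Import all_classical all_reals all_analysis.
Set Implicit Arguments.
Unset Strict Implicit.
Unset Printing Implicit Defensive.
Import Order.TTheory GRing.Theory Num.Theory.
Import numFieldNormedType.Exports.
Local Open Scope classical_set_scope.
Local Open Scope ring_scope.

(* Along the path, d/dc H(sigma(c h)) = h <grad H(sigma(c h)), sigma'(c h)>.
   Integrating over [0,1] and expanding sigma' in the P_i turns H(y1) - H(y0)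
   into h \sum_(i, j) gamma_i^T rho_ij gamma_j, the quadratic form of the block
   matrix (rho_ij). Since rho_ij = rho_ji and S is skew-symmetric, that block
   matrix is skew-symmetric and the form vanishes. *)

Lemma Rintegral_sum d (T : measurableType d) (R : realType)
    (mu : {measure set T -> \bar R}) (D : set T) (I : Type) (r : seq I)
    (f : I -> T -> R) :
  measurable D -> (forall i, mu.-integrable D (EFin \o f i)) ->
  \int[mu]_(x in D) (\sum_(i <- r) f i x) =
  \sum_(i <- r) \int[mu]_(x in D) f i x.
Proof.
move=> mD intf; rewrite /Rintegral.
under eq_integral do rewrite -sumEFin.
rewrite integral_sum// -sum_fine// => i _.
exact: (integrable_fin_num mD (intf i)).
Qed.

Lemma continuous_integrable_itv (R : realType) (f : R -> R) (a b : R) :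
  continuous f ->
  (@lebesgue_measure R).-integrable `[a, b] (EFin \o f).
Proof.
move=> cf; apply: continuous_compact_integrable; first exact: segment_compact.
exact: continuous_subspaceT.
Qed.

(** Transposing [Q] and exchanging the two sums turns each block [A i j] into [(A i j)^T = - A j i],
    so [Q^T = - Q]; but [Q] is 1 x 1, hence its own transpose. *)
Lemma skew_block_form_eq0 (R : numDomainType) (m s : nat)
    (A : 'I_s -> 'I_s -> 'M[R]_m) (g : 'I_s -> 'cV[R]_m) :
  (forall i j, A j i = - (A i j)^T) ->
  \sum_i \sum_j (g i)^T *m A i j *m g j = 0.
Proof.
move=> skewA; set Q := \sum_i _.
have QN : Q^T = - Q.
  rewrite {1}/Q exchange_big raddf_sum -sumrN; apply: eq_bigr => j _.
  rewrite raddf_sum -sumrN; apply: eq_bigr => i _.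
  rewrite /= !trmx_mul trmxK (skewA j i) linearN /= trmxK.
  by rewrite mulmxA mulmxN mulNmx.
(* The single entry of [Q] equals its own opposite, which forces it to be 0 in a numeric domain. *)
have /matrixP/(_ 0 0) := QN; rewrite mxE [RHS]mxE => /esym/eqP.
rewrite eqNr => /eqP Q0.
by apply/matrixP => i j; rewrite !ord1 Q0 mxE.
Qed.

Lemma derive1_col_horner (R : realType) (m : nat) (p : 'I_m -> {poly R})
    (t : R) :
  derivable (fun x => \col_k (p k).[x]) t 1 /\
  derive1 (fun x => \col_k (p k).[x]) t = \col_k (p k)^`().[t].
Proof.
have dp : derivable (fun x => \col_k (p k).[x]) t 1.
  apply/derivable_mxP => i j.
  under eq_fun do rewrite mxE.
  exact: derivable_horner.
split=> //; rewrite derive1E derive_mx//; apply/matrixP => i j; rewrite !mxE.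
by under eq_fun do rewrite mxE; rewrite -derive1E -derivE.
Qed.

Lemma derive1_comp_grad (R : realType) (m : nat) (H : 'cV[R]_m -> R)
    (g : R -> 'cV[R]_m) (t : R) :
  differentiable H (g t) -> derivable g t 1 ->
  derivable (H \o g) t 1 /\
  derive1 (H \o g) t = ((grad H (g t))^T *m derive1 g t) 0 0.
Proof.
move=> dH /derivable1_diffP dg; have dHg := differentiable_comp dg dH.
split; first exact/derivable1_diffP.
rewrite derive1E' // diff_comp//= -derive1E'//.
(* Expand the velocity in the canonical basis: by linearity the differential of [H] is determined by
   its values on the [delta_mx k 0], which are the entries of [grad H]. *)
rewrite {1}[derive1 g t]matrix_sum_delta linear_sum/= mxE.
apply: eq_bigr => k _.
by rewrite big_ord1 linearZ/= !mxE deriveE// mulrC.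
Qed.

Section EnergyConservation.
Context (R : realType) (m : nat) (H : 'cV[R]_m -> R) (S : 'cV[R]_m -> 'M[R]_m).
Context (P : nat -> {poly R}) (s : nat) (h : R) (sigma : R -> 'cV[R]_m).
Context (dH : forall y, differentiable H y) (cgradH : continuous (grad H)).
Context (cS : continuous S) (csigma : continuous sigma).

Let gamma := gamma_coef P H h sigma.
Let rho := rho_coef P S h sigma.
Let Gamma := Gamma_coef P S H h sigma s.

Lemma continuous_path_rescale : continuous (fun c : R => sigma (c * h)).
Proof.
by move=> c; apply: continuous_comp; [exact: mulrr_continuous|exact: csigma].
Qed.

(** The shape q x n is left free so that both the column [grad H] and the square matrix [S] are
    covered. *)
Lemma continuous_path_coord (q n : nat) (F : 'cV[R]_m -> 'M[R]_(q, n)) k l :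
  continuous F -> continuous (fun c : R => F (sigma (c * h)) k l).
Proof.
move=> cF c; apply: (@continuous_comp _ _ _ (fun c : R => F (sigma (c * h)))
  (fun M : 'M[R]_(q, n) => M k l)); last exact: coord_continuous.
apply: (@continuous_comp _ _ _ (fun c : R => sigma (c * h)) F); last exact: cF.
exact: continuous_path_rescale.
Qed.

Lemma continuous_gamma_integrand i k :
  continuous (fun c : R => (P i).[c] * grad H (sigma (c * h)) k 0).
Proof.
move=> c; apply: cvgM; first exact: continuous_horner.
exact: continuous_path_coord.
Qed.

Lemma continuous_rho_integrand i j k l :
  continuous (fun c : R => (P i).[c] * (P j).[c] * S (sigma (c * h)) k l).
Proof.
move=> c; apply: cvgM; first by apply: cvgM; exact: continuous_horner.
exact: continuous_path_coord.
Qed.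

(** The weight [P i * P j] is symmetric in i and j, and [S] is skew at each point of the path;
    entrywise integration preserves both facts. *)
Lemma rho_coef_skew : (forall y, skew_symmetric (S y)) ->
  forall i j, rho j i = - (rho i j)^T.
Proof.
move=> skewS i j; apply/matrixP => k l; rewrite !mxE -mulN1r -RintegralZl//.
  apply: eq_Rintegral => c _; rewrite {1}skewS !mxE mulN1r mulrN.
  by rewrite [(P j).[c] * _]mulrC.
exact/continuous_integrable_itv/continuous_rho_integrand.
Qed.

Lemma energy_increment :
  (forall c, 0 < c < 1 -> derivable (fun c : R => sigma (c * h)) c 1 /\
     derive1 (fun c : R => sigma (c * h)) c =
       h *: \sum_(i < s) (P i).[c] *: Gamma i) ->
  H (sigma h) - H (sigma 0) =
  (h *: \sum_(i < s) (gamma i)^T *m Gamma i) 0 0.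
Proof.
move=> dsigma.
(* The scalar terms of the derivative of [H (sigma (c * h))]. Indexing by pairs makes it one finite
   sum, and isolating the factor constant in c leaves exactly the integrand of [gamma]. *)
pose w (ik : 'I_s * 'I_m) c :=
  h * Gamma ik.1 ik.2 0 * ((P ik.1).[c] * grad H (sigma (c * h)) ik.2 0).
have cw ik : continuous (w ik).
  move=> c; apply: cvgM; first exact: cvg_cst.
  exact: continuous_gamma_integrand.
have cH : continuous (fun c : R => H (sigma (c * h))).
  move=> c; apply: (@continuous_comp _ _ _ (fun c : R => sigma (c * h)) H).
    exact: continuous_path_rescale.
  exact/differentiable_continuous.
have := @continuous_FTC2 R (fun c : R => \sum_(ik : 'I_s * 'I_m) w ik c)
  (fun c : R => H (sigma (c * h))) 0 1 ltr01 _ _ _.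
(* The fundamental theorem of calculus on [0,1] leaves four goals: the value of the integral,
   continuity of the integrand, regularity of the primitive (derivable inside, continuous at the
   ends), and the derivative formula. *)
rewrite mul1r mul0r -EFinB => /(_ _ _ _)/(congr1 fine) /= <-.
- rewrite -/(Rintegral _ _ _) Rintegral_sum//; last first.
    by move=> ik; exact/continuous_integrable_itv.
  transitivity (\sum_(ik : 'I_s * 'I_m)
      h * Gamma ik.1 ik.2 0 * gamma ik.1 ik.2 0).
    apply: eq_bigr => -[i k] _; rewrite RintegralZl//= ?mxE//.
    exact/continuous_integrable_itv/continuous_gamma_integrand.
  rewrite -(pair_bigA _ (fun (i : 'I_s) (k : 'I_m) =>
    h * Gamma i k 0 * gamma i k 0))/=.
  rewrite mxE summxE mulr_sumr; apply: eq_bigr => i _.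
  rewrite mxE mulr_sumr; apply: eq_bigr => k _.
  by rewrite [_^T _ _]mxE -mulrA [Gamma _ _ _ * _]mulrC.
- apply: continuous_subspaceT.
  apply: (@continuous_big _ _ _ _ xpredT add_continuous) => ik _; exact: cw.
- split=> [c||].
  + rewrite in_itv/= => /dsigma[ds _].
    exact: (derive1_comp_grad _ ds).1.
  + by apply: cvg_at_right_filter; exact: cH.
  + by apply: cvg_at_left_filter; exact: cH.
(* The chain rule, with the velocity replaced by its expansion in the [P i], gives the sum of the
   [w]. *)
- move=> c; rewrite in_itv/= => /dsigma[ds dsE].
  rewrite (derive1_comp_grad _ ds).2// dsE.
  rewrite -scalemxAr mxE mulmx_sumr summxE mulr_sumr.
  rewrite -(pair_bigA _ (fun (i : 'I_s) (k : 'I_m) => w (i, k) c))/=.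
  apply: eq_bigr => i _.
  rewrite -scalemxAr 2!mxE !mulr_sumr; apply: eq_bigr => k _.
  by rewrite [_^T _ _]mxE /w/= -mulrA; congr (_ * _); rewrite mulrA mulrC.
Qed.

End EnergyConservation.

Theorem theorem1 (R : realType) (m : nat)
    (H : 'cV[R]_m -> R) (S : 'cV[R]_m -> 'M[R]_m)
    (dH : forall y : 'cV[R]_m, differentiable H y)
    (smooth_gradH : smooth (grad H))
    (smooth_S : smooth S)
    (skew_S : forall y, skew_symmetric (S y))
    (P : nat -> {poly R}) (legP : orthonormal_legendre P)
    (s : nat) (s_ge1 : (1 <= s)%N) (h : R) (h_gt0 : 0 < h)
    (y0 y1 : 'cV[R]_m) (sigma : R -> 'cV[R]_m)
    (poly_sigma : polynomial_path s sigma)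
    (sigma0 : sigma 0 = y0)
    (dsigma : forall c : R, 0 <= c <= 1 ->
       derive1 sigma (c * h) =
         \sum_(i < s) (P i).[c] *: Gamma_coef P S H h sigma s i)
    (sigmah : y1 = sigma h) :
  H y1 = H y0.
Proof.
have [p [_ sigmaE]] := poly_sigma.
have {}sigmaE : sigma = fun t => \col_k (p k).[t] by apply/funext.
(* The rescaled path is again polynomial, so its derivative follows from the composition rule for
   polynomials, which produces the factor h. *)
have sigmaME : (fun c : R => sigma (c * h)) =
    (fun c => \col_k (p k \Po (h *: 'X)).[c]).
  apply/funext => c; rewrite sigmaE; apply/matrixP => i j.
  by rewrite !mxE horner_comp !hornerE mulrC.
have csigma : continuous sigma.
  move=> t; apply/differentiable_continuous/derivable1_diffP.
  by rewrite sigmaE; exact: (derive1_col_horner p t).1.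
apply/eqP; rewrite -subr_eq0 sigmah -sigma0.
rewrite (@energy_increment R m H S P s h sigma)//; last 2 first.
(* Order 0 of smoothness is continuity. *)
- exact: (smooth_gradH 0%N).
- move=> c /andP[c0 c1].
  have c01 : 0 <= c <= 1 by rewrite !ltW.
  rewrite -(dsigma _ c01) sigmaME.
  have [? ->] := derive1_col_horner (fun k => p k \Po (h *: 'X)) c.
  split=> //; rewrite sigmaE (derive1_col_horner p _).2.
  apply/matrixP => i j; rewrite !mxE deriv_comp hornerM horner_comp.
  by rewrite derivZ derivX !hornerZ hornerC hornerX mulr1 mulrC [h * c]mulrC.
(* Unfolding [Gamma_coef] exposes the quadratic form of the blocks [rho_coef]. *)
under eq_bigr do rewrite /Gamma_coef mulmx_sumr.
under eq_bigr do under eq_bigr do rewrite mulmxA.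
rewrite skew_block_form_eq0 ?scaler0 ?mxE// => i j.
by apply: rho_coef_skew => //; exact: (smooth_S 0%N).
Qed.
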